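(* Let $A\in\mathbb{R}^{n\times n}$, $B\in\mathbb{R}^{n\times m}$, $C\in\mathbb{R}^{p\times n}$, $D\in\mathbb{R}^{p\times m}$, and let $\Sigma$ be the system associated with $(A,B,C,D)$. Let $\lambda_1,\ldots,\lambda_h\in\mathbb{C}$ be self-conjugate (as a set), distinct and disjoint from the invariant zeros of $\Sigma$. For each $i\in\{1,\dots,h\}$ let $\begin{bmatrix} V_i \\ W_i \end{bmatrix}$ be a basis matrix of $\ker P_{\lambda_i}$, where $V_i$ has $n$ rows and $W_i$ has $m$ rows. Then the reachability subspace $\mathcal{R}_h$ on the output-nulling subspace $\operatorname{im}\,[\,V_1\;\;V_2\;\;\cdots\;\;V_h\,]$ is $\mathcal{V}^\star_{\mathcal{S}_h}$, the supremal output-nulling subspace contained in $\mathcal{S}_h$.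
   Context: Let $\mathcal{X}=\mathbb{R}^n$, $\mathcal{U}=\mathbb{R}^m$. The Rosenbrock matrix pencil is $P_\lambda=\begin{bmatrix}A-\lambda I& B\\ C& D\end{bmatrix}$. A basis matrix for a subspace is a matrix whose columns form a basis of it. A subspace $\mathcal{V}\subseteq\mathcal{X}$ is output-nulling if there exists $F\in\mathbb{R}^{m\times n}$ with $(A+BF)\mathcal{V}\subseteq\mathcal{V}\subseteq\ker(C+DF)$; such an $F$ is called a friend of $\mathcal{V}$. For a subspace $\mathcal{E}\subseteq\mathcal{X}$, $\mathcal{V}^\star_{\mathcal{E}}$ denotes the largest output-nulling subspace contained in $\mathcal{E}$, and $\mathcal{V}^\star=\mathcal{V}^\star_{\mathcal{X}}$. For an output-nulling subspace $\mathcal{V}$ with friend $F$, the reachability subspace on $\mathcal{V}$ is $\mathcal{R}_{\mathcal{V}}=\langle A+BF\,|\,\mathcal{V}\cap B\ker D\rangle$, the smallest $(A+BF)$-invariant subspace containing $\mathcal{V}\cap B\ker D$ (independent of the friend $F$); $\mathcal{R}^\star=\mathcal{R}_{\mathcal{V}^\star}$. The invariant zeros of $\Sigma$ are the eigenvalues of the map induced by $A+BF$ on $\mathcal{V}^\star/\mathcal{R}^\star$ for any friend $F$ of $\mathcal{V}^\star$ (equivalently, the $\lambda\in\mathbb{C}$ at which $P_\lambda$ loses rank with respect to its normal rank). The sequence $(\mathcal{S}_i)_{i\ge 0}$ is defined by $\mathcal{S}_0=\{0\}\subseteq\mathcal{X}$ and $\mathcal{S}_{i+1}=[\,A\;\;B\,]\big((\mathcal{S}_i\oplus\mathcal{U})\cap\ker[\,C\;\;D\,]\big)$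 for $i\ge 0$. Convention for non-real $\lambda_i$: for a complex conjugate pair $\lambda_i,\lambda_{i+1}=\bar\lambda_i$, the matrices $V_i,V_{i+1}$ are chosen complex conjugate and are replaced by $\operatorname{Re}V_i$ and $\operatorname{Im}V_i$ in $[V_1\;\cdots\;V_h]$, so that its image is a subspace of $\mathbb{R}^n$ (for real $\lambda_i$, $V_i$ is taken real). It is known that this image is output-nulling. *)

(* Defs.v *)
From HB Require Import structures.
From mathcomp Require Import all_boot all_order all_algebra.
From mathcomp Require Import reals complex.

Set Implicit Arguments.
Unset Strict Implicit.
Unset Printing Implicit Defensive.
Import Order.TTheory GRing.Theory Num.Theory.
Local Open Scope ring_scope.

(* Matrices act on column vectors: [mxfun M] is x |-> M *m x, so that
   [limg (mxfun M)] is the column space of M and [lker (mxfun M)] its right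
   kernel. *)
Definition mxfun (K : fieldType) (p q : nat) (M : 'M[K]_(p, q)) :
  'Hom('cV[K]_q, 'cV[K]_p) := linfun (mulmx M).

Definition basis_mx (K : fieldType) (p k : nat) (M : 'M[K]_(p, k))
    (U : {vspace 'cV[K]_p}) : bool :=
  basis_of U [seq col j M | j : 'I_k].

Definition smallest_invariant (K : fieldType) (n : nat) (G : 'M[K]_n)
    (W U : {vspace 'cV[K]_n}) : Prop :=
  [/\ (mxfun G @: U <= U)%VS, (W <= U)%VS &
      forall U' : {vspace 'cV[K]_n},
        (mxfun G @: U' <= U')%VS -> (W <= U')%VS -> (U <= U')%VS].

Definition friend (K : fieldType) (n m p : nat) (A : 'M[K]_n)
    (B : 'M[K]_(n, m)) (C : 'M[K]_(p, n)) (D : 'M[K]_(p, m))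
    (F : 'M[K]_(m, n)) (V : {vspace 'cV[K]_n}) : Prop :=
  (mxfun (A + B *m F) @: V <= V)%VS /\ (V <= lker (mxfun (C + D *m F)))%VS.

Definition output_nulling (K : fieldType) (n m p : nat) (A : 'M[K]_n)
    (B : 'M[K]_(n, m)) (C : 'M[K]_(p, n)) (D : 'M[K]_(p, m))
    (V : {vspace 'cV[K]_n}) : Prop :=
  exists F : 'M[K]_(m, n), friend A B C D F V.

Definition supremal_output_nulling (K : fieldType) (n m p : nat)
    (A : 'M[K]_n) (B : 'M[K]_(n, m)) (C : 'M[K]_(p, n)) (D : 'M[K]_(p, m))
    (E V : {vspace 'cV[K]_n}) : Prop :=
  [/\ output_nulling A B C D V, (V <= E)%VS &
      forall V' : {vspace 'cV[K]_n},
        output_nulling A B C D V' -> (V' <= E)%VS -> (V' <= V)%VS].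

Definition reachability_subspace (K : fieldType) (n m p : nat)
    (A : 'M[K]_n) (B : 'M[K]_(n, m)) (C : 'M[K]_(p, n)) (D : 'M[K]_(p, m))
    (V U : {vspace 'cV[K]_n}) : Prop :=
  exists2 F : 'M[K]_(m, n), friend A B C D F V &
    smallest_invariant (A + B *m F) (V :&: mxfun B @: lker (mxfun D))%VS U.

(* The matrix [G'] represents the map induced by [G] on the quotient V / U:
   the linear map x |-> Q *m x sends V onto K^q with kernel U on V, i.e. it
   provides coordinates on V / U, and it intertwines [G] and [G']. *)
Definition induced_on_quotient (K : fieldType) (n q : nat) (G : 'M[K]_n)
    (V U : {vspace 'cV[K]_n}) (G' : 'M[K]_q) : Prop :=
  exists Q : 'M[K]_(q, n),
    [/\ (mxfun Q @: V)%VS = fullv,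
        (V :&: lker (mxfun Q))%VS = U &
        forall x : 'cV[K]_n, x \in V -> Q *m (G *m x) = G' *m (Q *m x)].

(* The spectrum of the induced map depends on none of the witnesses below
   (friend, coordinates on the quotient). *)
Definition invariant_zero (R : realType) (n m p : nat) (A : 'M[R]_n)
    (B : 'M[R]_(n, m)) (C : 'M[R]_(p, n)) (D : 'M[R]_(p, m))
    (z : R[i]) : Prop :=
  exists (Vs Rs : {vspace 'cV[R]_n}) (F : 'M[R]_(m, n))
         (q : nat) (G : 'M[R]_q),
    [/\ supremal_output_nulling A B C D fullv Vs,
        reachability_subspace A B C D Vs Rs,
        friend A B C D F Vs,
        induced_on_quotient (A + B *m F) Vs Rs G &
        eigenvalue (map_mx (real_complex R) G) z].

Definition rosenbrock (R : realType) (n m p : nat) (A : 'M[R]_n)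
    (B : 'M[R]_(n, m)) (C : 'M[R]_(p, n)) (D : 'M[R]_(p, m))
    (z : R[i]) : 'M[R[i]]_(n + p, n + m) :=
  block_mx (map_mx (real_complex R) A - z%:M) (map_mx (real_complex R) B)
           (map_mx (real_complex R) C) (map_mx (real_complex R) D).

(* The preimage of S_i under (x, u) |-> x is the direct sum of S_i and of the
   whole input space. *)
Fixpoint Sseq (K : fieldType) (n m p : nat) (A : 'M[K]_n)
    (B : 'M[K]_(n, m)) (C : 'M[K]_(p, n)) (D : 'M[K]_(p, m))
    (i : nat) : {vspace 'cV[K]_n} :=
  if i is j.+1 then
    (mxfun (row_mx A B) @:
      ((linfun (@usubmx K n m 1) @^-1: Sseq A B C D j)
         :&: lker (mxfun (row_mx C D))))%VS
  else 0%VS.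

Definition conj_mx (R : realType) (n k l : nat) (M : 'M[R[i]]_(n, k))
    (N : 'M[R[i]]_(n, l)) : Prop :=
  exists e : k = l, N = castmx (erefl n, e) (map_mx (@conjc R) M).

(* The real form of [V_1 ... V_h].  When V_i is real for real lam_i and
   V_j = conj V_i for a non-real pair lam_j = conj lam_i, this keeps V_i for
   real lam_i and puts Re V_i and Im V_i (the latter up to sign) in place of
   the two blocks of such a pair. *)
Definition real_blocks (R : realType) (n h : nat) (lam : 'I_h -> R[i])
    (k : 'I_h -> nat) (V : forall i : 'I_h, 'M[R[i]]_(n, k i)) :
    'M[R]_(n, \sum_(i < h) k i) :=
  \mxrow_(i < h) (if complex.Im (lam i) < 0 then map_mx (@complex.Im R) (V i)
                  else map_mx (@complex.Re R) (V i)).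

(* Main.v *)
Require Import Defs.
From HB Require Import structures.
From mathcomp Require Import all_boot all_order all_algebra.
From mathcomp Require Import reals complex.
Set Implicit Arguments.
Unset Strict Implicit.
Unset Printing Implicit Defensive.
Import Order.TTheory GRing.Theory Num.Theory.
Local Open Scope ring_scope.

(** Write V_h for the image of [V_1 ... V_h] and S_i for the sequence ending at
    S_h.  Put N_0 = 0 and let N_(i+1) consist of the states of V_h that are
    reached in one output-nulling step from N_i ([reach_in]).  Clearly N_i lies
    in V_h and in S_i.  The theorem follows from R_h = N_h and from the fact
    that N_h contains every output-nulling subspace of S_h.

    The chain is stationary from h on ([reach_in_stable], [reach_in_Vh_stable]).
    A vector b of V_h is the real part of a sum of vectors v_i with v_i in the
    image of V_i.  The real parts t_j of the sums of lam_i ^ j v_i form an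
    output-nulling trajectory in V_h that starts at b, and t_h is a real
    combination of t_0, ..., t_(h-1): the polynomial with roots lam_i has degree
    h, and it is real because the lam_i are self-conjugate.  If b also lies in
    B ker D, then every t_j with j < h, hence also t_h, lies in N_h.
    Subtracting t from a trajectory that reaches y in N_(h+1) and whose state
    after one step is b gives a trajectory that is one step shorter, so y - t_h is in
    N_h.  Hence N_h is invariant under A + B F for every friend F of V_h, and it
    is then the smallest such subspace containing V_h meet B ker D
    ([smallest_invariant_reach_in]).

    An output-nulling subspace T of S_h lies in V_h
    ([annihilator_output_nulling], [output_nulling_Sseq_sub_Vh]).  By duality it
    is enough that a row phi annihilating V_h annihilates T.  Such a phi
    annihilates every V_i, so (phi, 0) = (psi_i, eta_i) P_(lam_i).  Choose
    weights c_i for which the sum of c_i lam_i ^ j is 0 for j < h - 1 and 1 for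
    j = h - 1, and let theta_j be the sum of c_i lam_i ^ j psi_i.  Along an
    output-nulling step from s to s', theta_j s' = theta_(j+1) s for j < h - 1,
    with an extra term phi s for j = h - 1.  Thus theta_j annihilates S_(h-j);
    in particular theta_0 annihilates T, and following steps that stay in T, so
    does every theta_j with j < h.  So does theta_h, which is a combination of
    these, and the relation for j = h - 1 then gives phi = 0 on T.

    Finally T lies in N_h ([sub_reach_in]): if x in T is reached from s in S_i,
    then T + <s> is again an output-nulling subspace of S_h, so an induction
    on i applies to it, and x itself is in V_h. *)

(** * Output-nulling steps and the spaces that they reach *)

Lemma mxfunE (K : fieldType) (p q : nat) (M : 'M[K]_(p, q)) x :
  mxfun M x = M *m x.
Proof. by rewrite lfunE. Qed.

Section System.

Variables (K : fieldType) (n m p : nat).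
Variables (A : 'M[K]_n) (B : 'M[K]_(n, m)) (C : 'M[K]_(p, n)) (D : 'M[K]_(p, m)).

Local Notation vspaceX := {vspace 'cV[K]_n}.

(** The one-step operator behind the sequence S_i: [Sseq A B C D i.+1] is
    [null_successors (Sseq A B C D i)] by conversion. *)
Definition null_successors (E : vspaceX) : vspaceX :=
  (mxfun (row_mx A B) @:
     ((linfun (@usubmx K n m 1) @^-1: E) :&: lker (mxfun (row_mx C D))))%VS.

Lemma null_successorsP (E : vspaceX) (x : 'cV[K]_n) :
  reflect (exists s (u : 'cV[K]_m),
             [/\ s \in E, C *m s + D *m u = 0 & x = A *m s + B *m u])
          (x \in null_successors E).
Proof.
apply: (iffP memv_imgP) => [[z] | [s [u [sE zero ->]]]].
  rewrite memv_cap memv_ker -memv_preim lfunE /= => /andP[zE /eqP].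
  rewrite !mxfunE -{1 2}[z]vsubmxK !mul_row_col => zero ->.
  by exists (usubmx z), (dsubmx z); split; rewrite // -{1}[z]vsubmxK mul_row_col.
exists (col_mx s u); last by rewrite mxfunE mul_row_col.
rewrite memv_cap memv_ker -memv_preim lfunE /= col_mxKu sE mxfunE.
by rewrite mul_row_col zero eqxx.
Qed.

Lemma null_successorsS (E E' : vspaceX) :
  (E <= E')%VS -> (null_successors E <= null_successors E')%VS.
Proof.
move=> sEE'; apply/subvP => x /null_successorsP[s [u [sE zero ->]]].
by apply/null_successorsP; exists s, u; rewrite (subvP sEE').
Qed.

Lemma Sseq_mono i : (Sseq A B C D i <= Sseq A B C D i.+1)%VS.
Proof. by elim: i => [|i IHi]; [exact: sub0v | exact: null_successorsS]. Qed.

Lemma Sseq_le i j : (i <= j)%N -> (Sseq A B C D i <= Sseq A B C D j)%VS.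
Proof.
by move/subnKC <-; elim: (j - i)%N => [|k IHk];
  rewrite ?addn0 ?subvv // addnS (subv_trans IHk) ?Sseq_mono.
Qed.

(** Whether a subspace is output-nulling can be tested one vector at a time: a
    friend is obtained by prescribing the inputs on a basis and extending
    linearly. *)
Lemma output_nullingP (V : vspaceX) :
  output_nulling A B C D V <->
  (forall v, v \in V -> exists2 u, A *m v + B *m u \in V & C *m v + D *m u = 0).
Proof.
split=> [[F [/subvP invF /subvP kerF]] v vV | stepV].
  exists (F *m v).
    have := invF _ (memv_img _ vV).
    by rewrite mxfunE mulmxDl -mulmxA.
  have := kerF _ vV; rewrite memv_ker mxfunE mulmxDl -mulmxA.
  by move/eqP.
pose bV := vbasis V.
have step_i (i : 'I_(\dim V)) : exists u : 'cV[K]_m,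
    (A *m bV`_i + B *m u \in V) && (C *m bV`_i + D *m u == 0).
  have [|u uV u0] := stepV bV`_i; first by rewrite vbasis_mem ?mem_nth ?size_tuple.
  by exists u; rewrite uV u0 eqxx.
pose w i := xchoose (step_i i).
(* [coord] is defined on the whole space, so [f] is a linear map on it. *)
pose f (x : 'cV[K]_n) : 'cV[K]_m := \sum_i coord bV i x *: w i.
have f_lin : linear f.
  move=> a x y; rewrite /f scaler_sumr -big_split; apply: eq_bigr => i _.
  by rewrite linearP scalerDl scalerA.
pose Fl := GRing.isLinear.Build _ _ _ _ f f_lin.
pose F : 'M[K]_(m, n) := \matrix_(i, j) f (delta_mx j 0) i 0.
have FE x : F *m x = f x.
  pose fL : {linear 'cV[K]_n -> 'cV[K]_m} := HB.pack f Fl.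
  rewrite {2}[x]matrix_sum_delta -[f _]/(fL _) linear_sum.
  apply/matrixP=> i j; rewrite !ord1 mxE summxE; apply: eq_bigr => l _.
  by rewrite big_ord1 linearZ !mxE mulrC.
have dec x : x \in V -> x = \sum_i coord bV i x *: bV`_i.
  by move=> xV; rewrite -coord_vbasis.
exists F; split; apply/subvP => x.
  case/memv_imgP=> v vV ->; rewrite mxfunE mulmxDl -mulmxA FE /f {1}(dec v vV).
  rewrite !mulmx_sumr -big_split memv_suml // => i _.
  rewrite -!scalemxAr /= -scalerDr memvZ //.
  by case/andP: (xchooseP (step_i i)).
move=> xV; rewrite memv_ker mxfunE mulmxDl -mulmxA FE /f {1}(dec x xV).
rewrite !mulmx_sumr -big_split big1 // => i _.
rewrite -!scalemxAr /= -scalerDr.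
by case/andP: (xchooseP (step_i i)) => _ /eqP ->; rewrite scaler0.
Qed.

(** A predecessor of a vector of T can be adjoined to T.  This plays the
    part of the maximality of the supremal subspace in the usual argument. *)
Lemma output_nulling_add_pred (T : vspaceX) s u :
  output_nulling A B C D T -> A *m s + B *m u \in T -> C *m s + D *m u = 0 ->
  output_nulling A B C D (T + <[s]>)%VS.
Proof.
move=> /output_nullingP nullT sT s0; apply/output_nullingP => v.
case/memv_addP=> t tT [_ /vlineP[a ->] ->].
have [w wT w0] := nullT t tT.
exists (w + a *: u); rewrite !mulmxDr -!scalemxAr addrACA -scalerDr.
  by rewrite memvD // (subvP (addvSl _ _)) // memvZ.
by rewrite s0 scaler0 addr0.
Qed.

(** The states reachable from the origin in i steps along output-nulling
    trajectories inside V.  Unlike the powers of A + B F applied to the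
    intersection of V and B ker D, this does not refer to a friend. *)
Fixpoint reach_in (V : vspaceX) (i : nat) : vspaceX :=
  if i is j.+1 then (V :&: null_successors (reach_in V j))%VS else 0%VS.

Variable V : vspaceX.

Lemma reach_in_sub i : (reach_in V i <= V)%VS.
Proof. by case: i => [|i]; rewrite ?sub0v ?capvSl. Qed.

Lemma reach_in_mono i : (reach_in V i <= reach_in V i.+1)%VS.
Proof. by elim: i => [|i IHi]; rewrite ?sub0v // capvS ?null_successorsS. Qed.

Lemma reach_in_le i j : (i <= j)%N -> (reach_in V i <= reach_in V j)%VS.
Proof.
by move/subnKC <-; elim: (j - i)%N => [|k IHk];
  rewrite ?addn0 ?subvv // addnS (subv_trans IHk) ?reach_in_mono.
Qed.

Lemma reach_in_Sseq i : (reach_in V i <= Sseq A B C D i)%VS.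
Proof.
elim: i => [|i IHi]; first exact: subvv.
by rewrite (subv_trans (capvSr _ _)) // null_successorsS.
Qed.

Lemma reach_in_1 : reach_in V 1 = (V :&: mxfun B @: lker (mxfun D))%VS.
Proof.
congr (_ :&: _)%VS; apply/eqP; rewrite eqEsubv.
apply/andP; split; apply/subvP => x.
  case/null_successorsP=> s [u []]; rewrite memv0 => /eqP ->.
  rewrite !mulmx0 !add0r => u0 ->; rewrite -mxfunE memv_img //.
  by rewrite memv_ker mxfunE u0.
case/memv_imgP=> u; rewrite memv_ker => /eqP; rewrite !mxfunE => u0 ->.
by apply/null_successorsP; exists 0, u; rewrite mem0v !mulmx0 !add0r.
Qed.

(** A step inside V from s to x differs from the closed-loop step with friend F
    by an element of V meet B ker D.  Therefore the chain stays in every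
    invariant subspace that contains this intersection, and once stationary the
    chain is invariant itself. *)
Lemma smallest_invariant_reach_in h F :
  friend A B C D F V -> (reach_in V h.+1 <= reach_in V h)%VS ->
  smallest_invariant (A + B *m F) (V :&: mxfun B @: lker (mxfun D))%VS
    (reach_in V h).
Proof.
move=> [/subvP invV /subvP kerV] stab; rewrite -reach_in_1; split.
- apply/subvP => _ /memv_imgP[x xN ->].
  have xV := subvP (reach_in_sub h) _ xN.
  apply: (subvP stab); rewrite memv_cap invV ?memv_img //=.
  apply/null_successorsP; exists x, (F *m x); split=> //.
    by have := kerV x xV; rewrite memv_ker mxfunE mulmxDl mulmxA => /eqP.
  by rewrite mxfunE mulmxDl mulmxA.
- by rewrite (subv_trans _ stab) // reach_in_le.
move=> U' invU' subU'; elim: (h) => [|i IHi]; first exact: sub0v.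
apply/subvP => x; rewrite memv_cap => /andP[xV /null_successorsP[s [u [sN s0 def_x]]]].
have sV := subvP (reach_in_sub i) _ sN.
have -> : x = mxfun (A + B *m F) s + B *m (u - F *m s).
  by rewrite mxfunE def_x mulmxBr mulmxDl mulmxA addrACA subrr addr0.
have FsU : mxfun (A + B *m F) s \in U'.
  by rewrite (subvP invU') ?memv_img // (subvP IHi).
rewrite memvD // (subvP subU') // reach_in_1 memv_cap; apply/andP; split.
  have -> : B *m (u - F *m s) = x - mxfun (A + B *m F) s.
    by rewrite mxfunE def_x mulmxBr mulmxDl mulmxA opprD addrACA subrr add0r.
  by rewrite memvB // invV ?memv_img.
rewrite -mxfunE memv_img // memv_ker mxfunE mulmxBr mulmxA.
have := kerV s sV; rewrite memv_ker mxfunE mulmxDl => /eqP/(canRL (addKr _)).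
by rewrite addr0 => ->; rewrite opprK addrC s0.
Qed.

Lemma smallest_invariant_uniq (G : 'M[K]_n) (E U U' : vspaceX) :
  smallest_invariant G E U -> smallest_invariant G E U' -> U = U'.
Proof.
move=> [iU sU minU] [iU' sU' minU']; apply/eqP.
by rewrite eqEsubv minU ?minU'.
Qed.

Lemma output_nulling_reach_in h F :
  friend A B C D F V -> (reach_in V h.+1 <= reach_in V h)%VS ->
  output_nulling A B C D (reach_in V h).
Proof.
move=> frF stab; have [inv _ _] := smallest_invariant_reach_in frF stab.
exists F; split=> //; case: frF => _; exact/subv_trans/reach_in_sub.
Qed.

(** The role of the minimal polynomial in the usual Krylov argument is played
    by a trajectory from each b whose h-th state depends linearly on the earlier
    ones; no friend with a diagonalizable closed loop has to be built. *)
Lemma reach_in_stable h :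
  (forall b, b \in V ->
     exists (t : nat -> 'cV[K]_n) (w : nat -> 'cV[K]_m) (a : 'I_h -> K),
     [/\ t 0 = b, forall j, t j \in V,
         forall j, t j.+1 = A *m t j + B *m w j,
         forall j, C *m t j + D *m w j = 0
       & t h = \sum_(j < h) a j *: t j]) ->
  (reach_in V h.+1 <= reach_in V h)%VS.
Proof.
move=> recV.
(* Here b is the state after the first step on the way to y.  Subtracting t from the
   rest of the way makes it start at the origin, so one step is saved. *)
have split_y j y : y \in reach_in V j.+1 ->
   exists2 b, b \in reach_in V 1 & forall (t : nat -> 'cV[K]_n) (w : nat -> 'cV[K]_m),
     t 0 = b -> (forall j, t j \in V) ->
     (forall j, t j.+1 = A *m t j + B *m w j) ->
     (forall j, C *m t j + D *m w j = 0) -> y - t j \in reach_in V j.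
  elim: j y => [|j IHj] y yN.
    by exists y => // t w -> *; rewrite subrr mem0v.
  move: yN; rewrite memv_cap => /andP[yV /null_successorsP[s [u [sN s0 def_y]]]].
  have [b b1 sb] := IHj s sN; exists b => // t w t0 tV tS tz.
  rewrite memv_cap; apply/andP; split; first by rewrite memvB.
  apply/null_successorsP; exists (s - t j), (u - w j).
  rewrite (sb t w) // !mulmxBr; split=> //.
    by rewrite addrACA s0 -opprD tz subrr.
  by rewrite def_y tS addrACA -opprD.
apply/subvP => y yN; have [b b1 yb] := split_y h y yN.
have [t [w [a [t0 tV tS tz th]]]] :=
  recV b (subvP (reach_in_sub 1) _ b1).
rewrite -(subrK (t h) y) memvD ?(yb t w) // th memv_suml // => j _; rewrite memvZ //.
have tN i : t i \in reach_in V i.+1.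
  elim: i => [|i IHi]; first by rewrite t0.
  rewrite memv_cap tV; apply/null_successorsP; exists (t i), (w i); split=> //.
by rewrite (subvP (reach_in_le (ltn_ord j))).
Qed.

(** The induction is over all T at once, because the predecessor of a vector of
    T is in general only in a larger output-nulling subspace. *)
Lemma sub_reach_in h :
  (forall T, output_nulling A B C D T -> (T <= Sseq A B C D h)%VS -> (T <= V)%VS) ->
  forall T, output_nulling A B C D T -> (T <= Sseq A B C D h)%VS ->
  (T <= reach_in V h)%VS.
Proof.
move=> subV.
suff key i : (i <= h)%N -> forall T, output_nulling A B C D T ->
    (T <= Sseq A B C D h)%VS -> (T :&: Sseq A B C D i <= reach_in V i)%VS.
  by move=> T nullT TS; rewrite -(capv_idPl TS) key.
elim: i => [|i IHi] i_le T nullT TS; first exact: capvSr.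
apply/subvP => x; rewrite memv_cap => /andP[xT /null_successorsP[s [u [sS s0 def_x]]]].
rewrite memv_cap (subvP (subV T nullT TS)) //=; apply/null_successorsP.
exists s, u; split=> //; rewrite def_x in xT.
apply: (subvP (IHi (ltnW i_le) (T + <[s]>)%VS _ _)).
- exact: output_nulling_add_pred xT s0.
- rewrite subv_add TS -memvE /=; exact: (subvP (Sseq_le (ltnW i_le))).
by rewrite memv_cap sS (subvP (addvSr _ _)) ?memv_line.
Qed.

End System.
(** * Moments of distinct nodes *)

Section Moments.

Variables (L : fieldType) (h : nat) (lam : 'I_h -> L).

Definition node_poly : {poly L} := \prod_i ('X - (lam i)%:P).

Lemma monic_root_pow (q : {poly L}) x : q \is monic -> size q = h.+1 -> root q x ->
  x ^+ h = \sum_(j < h) - q`_j * x ^+ j.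
Proof.
move=> /monicP lead_q size_q /rootP; rewrite horner_coef size_q big_ord_recr /=.
have -> : q`_h = 1 by rewrite -lead_q lead_coefE size_q.
rewrite mul1r => /(canRL (addKr _)); rewrite addr0 => ->.
by rewrite -sumrN; apply: eq_bigr => j _; rewrite mulNr.
Qed.

Lemma node_pow i : lam i ^+ h = \sum_(j < h) - node_poly`_j * lam i ^+ j.
Proof.
apply: monic_root_pow; first exact: monic_prod_XsubC.
  by rewrite size_prod_XsubC /index_enum -enumT size_enum_ord.
by rewrite /root horner_prod (bigD1 i) //= hornerXsubC subrr mul0r.
Qed.

End Moments.

(** These are the weights of the leading coefficient in Lagrange interpolation;
    they solve a Vandermonde system. *)
Lemma moment_weights (L : fieldType) h (lam : 'I_h.+1 -> L) : injective lam ->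
  exists c : 'I_h.+1 -> L, forall j : nat, (j <= h)%N ->
    \sum_i c i * lam i ^+ j = (j == h)%:R.
Proof.
move=> lam_inj; pose M := Vandermonde h.+1 (\row_i lam i).
have uM : M \in unitmx.
  rewrite unitmxE det_Vandermonde unitfE; apply/prodf_neq0 => i _.
  apply/prodf_neq0 => j ltij; rewrite !mxE subr_eq0.
  by apply: contraTneq ltij => /lam_inj ->; rewrite ltnn.
pose c := invmx M *m delta_mx ord_max (0 : 'I_1).
exists (fun i => c i 0) => j le_jh.
have /matrixP/(_ (inord j) 0) : M *m c = delta_mx ord_max 0 by rewrite mulKVmx.
rewrite !mxE eqxx andbT -val_eqE /= inordK // => <-.
by apply: eq_bigr => i _; rewrite !mxE inordK // mulrC.
Qed.

(** * Rows that annihilate output-nulling subspaces *)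

Section Duality.

Variables (K L : fieldType) (f : {rmorphism K -> L}) (n m p : nat).
Variables (A : 'M[K]_n) (B : 'M[K]_(n, m)) (C : 'M[K]_(p, n)) (D : 'M[K]_(p, m)).
Local Notation "M ^f" := (map_mx f M) : ring_scope.

(** The hypotheses say that (phi, 0) = (psi_i, eta_i) P_(lam_i).  The moments
    [th j] of the psi_i satisfy a recurrence in j that runs backwards along
    output-nulling steps ([th_step]), because the moments of the weights
    vanish for j < h - 1.  The nodes and the rows live
    over the extension L, the trajectories over K. *)
Lemma annihilator_output_nulling h (lam : 'I_h -> L) (phi : 'rV[L]_n)
    (psi : 'I_h -> 'rV[L]_n) (eta : 'I_h -> 'rV[L]_p) :
  injective lam ->
  (forall i, psi i *m A^f + eta i *m C^f = phi + lam i *: psi i) ->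
  (forall i, psi i *m B^f + eta i *m D^f = 0) ->
  forall T, output_nulling A B C D T -> (T <= Sseq A B C D h)%VS ->
  forall x, x \in T -> phi *m x^f = 0.
Proof.
case: h lam psi eta => [|h] lam psi eta lam_inj psiA psiB T;
  move=> /output_nullingP nullT TS x xT.
  by have := subvP TS x xT; rewrite memv0 => /eqP ->; rewrite map_mx0 mulmx0.
have [c cP] := moment_weights lam_inj.
pose th j := \sum_i (c i * lam i ^+ j) *: psi i.
pose et j := \sum_i (c i * lam i ^+ j) *: eta i.
have thA j : th j *m A^f + et j *m C^f =
             (\sum_i c i * lam i ^+ j) *: phi + th j.+1.
  rewrite !mulmx_suml scaler_suml -!big_split; apply: eq_bigr => i _ /=.
  by rewrite -!scalemxAl -scalerDr psiA scalerDr scalerA exprSr mulrA.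
have thB j : th j *m B^f + et j *m D^f = 0.
  rewrite !mulmx_suml -big_split big1 // => i _ /=.
  by rewrite -!scalemxAl -scalerDr psiB scaler0.
have th_step j (s : 'cV[K]_n) (u : 'cV[K]_m) : C *m s + D *m u = 0 ->
    th j *m (A *m s + B *m u)^f =
    (\sum_i c i * lam i ^+ j) *: (phi *m s^f) + th j.+1 *m s^f.
  move=> zero; rewrite scalemxAl -mulmxDl -thA.
  rewrite -[LHS]addr0 -[0](mulmx0 _ (et j)) -(map_mx0 f) -zero.
  rewrite !map_mxD !map_mxM !mulmxDr !mulmxA addrACA -!mulmxDl.
  by rewrite thB mul0mx addr0.
(* The moment of weight one is met only when i = 0, where s = 0. *)
have thS i j y : (i + j <= h.+1)%N -> y \in Sseq A B C D i -> th j *m y^f = 0.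
  elim: i j y => [|i IHi] j y le_h.
    by rewrite memv0 => /eqP ->; rewrite map_mx0 mulmx0.
  case/null_successorsP=> s [u [sS zero ->]].
  case: (posnP i) => [i0 | i_gt0].
    rewrite th_step //; move: sS; rewrite i0 memv0 => /eqP ->.
    by rewrite map_mx0 !mulmx0 scaler0 addr0.
  have lt_jh : (j < h)%N.
    by move: le_h; rewrite addSn ltnS; apply: leq_trans; rewrite -add1n leq_add2r.
  rewrite th_step // cP 1?ltnW // (ltn_eqF lt_jh) scale0r add0r.
  by rewrite IHi // addnS -addSn.
have thT j y : (j <= h)%N -> y \in T -> th j *m y^f = 0.
  elim: j y => [|j IHj] y lt_jh yT.
    by apply: (thS h.+1); rewrite ?addn0 ?(subvP TS).
  have [u yT' zero] := nullT y yT.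
  have := th_step j y u zero; rewrite IHj // 1?ltnW //.
  by rewrite cP 1?ltnW // (ltn_eqF lt_jh) scale0r add0r.
have [u xT' zero] := nullT x xT.
have := th_step h x u zero; rewrite thT // cP // eqxx scale1r.
suff -> : th h.+1 *m x^f = 0 by rewrite addr0.
(* All nodes are roots of a monic polynomial of degree h + 1, so the moment
   after the last one is a combination of those already treated. *)
have -> : th h.+1 = \sum_(j < h.+1) - (node_poly lam)`_j *: th j.
  under [RHS]eq_bigr => j _ do rewrite scaler_sumr.
  rewrite exchange_big; apply: eq_bigr => i _ /=.
  rewrite node_pow mulr_sumr scaler_suml; apply: eq_bigr => j _.
  by rewrite scalerA mulrCA.
rewrite mulmx_suml big1 // => j _.
by rewrite -scalemxAl thT ?scaler0 // -ltnS.
Qed.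

End Duality.
(** * Duality for matrices, real and imaginary parts *)

Lemma row_factor (K : fieldType) (q r : nat) (P : 'M[K]_(q, r)) (y : 'rV[K]_r) :
  (forall z : 'cV[K]_r, P *m z = 0 -> y *m z = 0) -> exists w, y = w *m P.
Proof.
move=> kerP; suff /submxP: (y <= P)%MS by [].
rewrite submxE; apply/eqP/matrixP => i j; rewrite ord1.
have := kerP (cokermx P *m delta_mx j 0).
rewrite mulmxA mulmx_coker mul0mx mulmxA -colE => /(_ erefl)/matrixP/(_ 0 0).
by rewrite !mxE.
Qed.

Lemma limg_annihilator (K : fieldType) (q r : nat) (M : 'M[K]_(q, r)) (x : 'cV[K]_q) :
  (forall phi : 'rV[K]_q, phi *m M = 0 -> phi *m x = 0) -> x \in limg (mxfun M).
Proof.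
move=> annM; have [z Mz | w def_x] := @row_factor K _ _ M^T x^T.
  by apply: trmx_inj; rewrite trmx_mul trmxK annM ?trmx0 // -[M]trmxK -trmx_mul Mz trmx0.
by rewrite -[x]trmxK def_x trmx_mul trmxK -mxfunE memv_img ?memvf.
Qed.

Section ComplexMatrices.

Variable R : realType.

Local Notation rcmx := (map_mx (real_complex R)).
Local Notation Remx := (map_mx (@complex.Re R)).
Local Notation Immx := (map_mx (@complex.Im R)).

Lemma Re_sum I (r : seq I) (P : pred I) (F : I -> R[i]) :
  complex.Re (\sum_(i <- r | P i) F i) = \sum_(i <- r | P i) complex.Re (F i).
Proof. by apply: big_morph => // -[? ?] []. Qed.

Lemma Im_sum I (r : seq I) (P : pred I) (F : I -> R[i]) :
  complex.Im (\sum_(i <- r | P i) F i) = \sum_(i <- r | P i) complex.Im (F i).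
Proof. by apply: big_morph => // -[? ?] []. Qed.

Lemma Remx_sum q r (I : finType) (F : I -> 'M[R[i]]_(q, r)) :
  Remx (\sum_i F i) = \sum_i Remx (F i).
Proof.
apply/matrixP => a b; rewrite mxE !summxE Re_sum.
by apply: eq_bigr => i _; rewrite mxE.
Qed.

Lemma Remx_mull q r s (M : 'M[R]_(q, r)) (Z : 'M[R[i]]_(r, s)) :
  Remx (rcmx M *m Z) = M *m Remx Z.
Proof.
apply/matrixP => a b; rewrite !mxE Re_sum; apply: eq_bigr => j _.
by rewrite !mxE; case: (Z j b) => x y /=; rewrite mul0r subr0.
Qed.

Lemma Immx_mull q r s (M : 'M[R]_(q, r)) (Z : 'M[R[i]]_(r, s)) :
  Immx (rcmx M *m Z) = M *m Immx Z.
Proof.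
apply/matrixP => a b; rewrite !mxE Im_sum; apply: eq_bigr => j _.
by rewrite !mxE; case: (Z j b) => x y /=; rewrite mul0r addr0.
Qed.

Lemma Remx_mulr q r s (Z : 'M[R[i]]_(q, r)) (M : 'M[R]_(r, s)) :
  Remx (Z *m rcmx M) = Remx Z *m M.
Proof.
apply: trmx_inj; by rewrite map_trmx !trmx_mul !map_trmx Remx_mull.
Qed.

Lemma RemxZ q r (c : R) (Z : 'M[R[i]]_(q, r)) :
  Remx (c%:C%C *: Z) = c *: Remx Z.
Proof. by rewrite -!mul_scalar_mx -Remx_mull map_scalar_mx. Qed.

Lemma RemxD q r (Z Z' : 'M[R[i]]_(q, r)) : Remx (Z + Z') = Remx Z + Remx Z'.
Proof. by apply/matrixP => a b; rewrite !mxE; case: (Z a b); case: (Z' a b). Qed.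

Lemma Remx_Ni q r (Z : 'M[R[i]]_(q, r)) : Remx (- 'i%C *: Z) = Immx Z.
Proof.
apply/matrixP => a b; rewrite !mxE; case: (Z a b) => x y /=.
by rewrite oppr0 mul0r mulN1r sub0r opprK.
Qed.

Lemma complexmx_eq0 q r (Z : 'M[R[i]]_(q, r)) : Remx Z = 0 -> Immx Z = 0 -> Z = 0.
Proof.
move=> /matrixP Re0 /matrixP Im0; apply/matrixP => a b.
by have := Re0 a b; have := Im0 a b; rewrite !mxE; case: (Z a b) => x y /= -> ->.
Qed.

Lemma conj_mx_annihilator n k l (M : 'M[R[i]]_(n, k)) (N : 'M[R[i]]_(n, l))
    (phi : 'rV[R]_n) : conj_mx M N ->
  (phi *m Remx N = 0 -> phi *m Remx M = 0) /\
  (phi *m Immx N = 0 -> phi *m Immx M = 0).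
Proof.
case=> e ->; case: l / e {N}; rewrite castmx_id.
have -> : Remx (map_mx conjc M) = Remx M.
  by apply/matrixP => a b; rewrite !mxE; case: (M a b).
have -> : Immx (map_mx conjc M) = - Immx M.
  by apply/matrixP => a b; rewrite !mxE; case: (M a b).
by rewrite mulmxN; split=> // /eqP; rewrite oppr_eq0 => /eqP.
Qed.

Lemma conj_mx_real n k (M : 'M[R[i]]_(n, k)) : conj_mx M M -> Immx M = 0.
Proof.
case=> e; rewrite (eq_irrelevance e (erefl k)) castmx_id => /matrixP MJ.
apply/matrixP => a b; rewrite !mxE; have := MJ a b; rewrite mxE.
case: (M a b) => x y [] /eqP; rewrite -addr_eq0 -mulr2n mulrn_eq0 /=.
by move/eqP.
Qed.

End ComplexMatrices.
(** * Superpositions of kernel vectors of the Rosenbrock pencil *)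

Section KernelModes.

Variables (R : realType) (n m p : nat).
Variables (A : 'M[R]_n) (B : 'M[R]_(n, m)) (C : 'M[R]_(p, n)) (D : 'M[R]_(p, m)).
Variables (h : nat) (lam : 'I_h -> R[i]) (k : 'I_h -> nat).
Variables (V : forall i : 'I_h, 'M[R[i]]_(n, k i)).
Variables (W : forall i : 'I_h, 'M[R[i]]_(m, k i)).

Hypothesis lam_distinct : injective lam.
Hypothesis lam_selfconj : forall i : 'I_h, exists j : 'I_h, lam j = conjc (lam i).
Hypothesis VW_basis : forall i : 'I_h,
  basis_mx (col_mx (V i) (W i)) (lker (mxfun (rosenbrock A B C D (lam i)))).
Hypothesis V_conj : forall i j : 'I_h, lam j = conjc (lam i) -> conj_mx (V i) (V j).

Local Notation rcmx := (map_mx (real_complex R)).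
Local Notation Remx := (map_mx (@complex.Re R)).
Local Notation Immx := (map_mx (@complex.Im R)).
Local Notation Vh := (limg (mxfun (real_blocks lam V))).

(** Conjugation permutes the nodes, hence fixes the polynomial that they
    define. *)
Lemma node_poly_real j :
  (complex.Re (node_poly lam)`_j)%:C%C = (node_poly lam)`_j.
Proof.
have conj_node : map_poly conjc (node_poly lam) = node_poly lam.
  have lam_selfconjb i : exists j, lam j == conjc (lam i).
    by have [l ll] := lam_selfconj i; exists l; apply/eqP.
  pose s i := xchoose (lam_selfconjb i).
  have sE i : lam (s i) = conjc (lam i) by apply/eqP/(xchooseP (lam_selfconjb i)).
  have s_inj : injective s.
    by move=> i l /(congr1 lam); rewrite !sE => /(can_inj (@conjcK R))/lam_distinct.
  rewrite /node_poly rmorph_prod [RHS](reindex_inj s_inj) /=.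
  by apply: eq_bigr => i _; rewrite rmorphB /= map_polyX map_polyC /= sE.
have := coef_map conjc (node_poly lam) j; rewrite conj_node.
case: (_`_j) => x y [] /eqP; rewrite -addr_eq0 -mulr2n mulrn_eq0 /=.
by move=> /eqP ->.
Qed.

Lemma kernel_modes i :
  rcmx A *m V i + rcmx B *m W i = lam i *: V i /\ rcmx C *m V i + rcmx D *m W i = 0.
Proof.
have : rosenbrock A B C D (lam i) *m col_mx (V i) (W i) = 0.
  apply/matrixP => a j; rewrite [RHS]mxE.
  have : col j (col_mx (V i) (W i)) \in lker (mxfun (rosenbrock A B C D (lam i))).
    by apply: (basis_mem (VW_basis i)); apply: image_f.
  rewrite memv_ker mxfunE colE mulmxA -colE => /eqP/matrixP/(_ a 0).
  by rewrite !mxE.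
rewrite mul_block_col -[0]vsubmxK => /eq_col_mx[]; rewrite !linear0.
rewrite mulmxBl mul_scalar_mx addrAC => /eqP; rewrite subr_eq0 => /eqP.
by [].
Qed.

Lemma kernel_spanned i (z : 'cV[R[i]]_(n + m)) :
  rosenbrock A B C D (lam i) *m z = 0 -> exists a, z = col_mx (V i) (W i) *m a.
Proof.
move=> Pz; have [/eqP span_VW _] := andP (VW_basis i).
have zK : z \in lker (mxfun (rosenbrock A B C D (lam i))).
  by rewrite memv_ker mxfunE Pz.
have /subvP/(_ z) : (lker (mxfun (rosenbrock A B C D (lam i))) <=
    limg (mxfun (col_mx (V i) (W i))))%VS.
  rewrite -span_VW; apply/span_subvP => _ /imageP[j _ ->].
  by rewrite colE -mxfunE memv_img ?memvf.
by case/(_ zK)/memv_imgP=> a _ ->; exists a; rewrite mxfunE.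
Qed.

(** A complex parametrization of the real space V_h: the conjugate blocks give
    redundant parameters, but the action of the lam_i becomes diagonal. *)
Definition superpose q (M : forall i, 'M[R[i]]_(q, k i))
    (a : forall i, 'cV[R[i]]_(k i)) : 'cV[R]_q :=
  Remx (\sum_i M i *m a i).

(** For a non-real pair, one block carries the real part and the other one the
    imaginary part of the same matrix up to sign, so that a real row vanishing
    on both vanishes on the complex matrix. *)
Lemma real_blocks_annihilator (phi : 'rV[R]_n) :
  phi *m real_blocks lam V = 0 -> forall i, rcmx phi *m V i = 0.
Proof.
rewrite mul_mxrow -mxrow0 => /eq_mxrowP phiV i.
have [j lamj] := lam_selfconj i.
have [annRe annIm] := conj_mx_annihilator phi (V_conj lamj).
have := phiV i; have := phiV j; rewrite lamj.
have -> : complex.Im (conjc (lam i)) = - complex.Im (lam i) by case: (lam i).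
rewrite oppr_lt0 => phij phii.
apply: complexmx_eq0; rewrite ?Remx_mull ?Immx_mull; case: ltgtP phii phij => //.
move=> lam_real _ _; rewrite (@conj_mx_real _ _ _ (V i)) ?mulmx0 //.
by apply: V_conj; move: lam_real; case: (lam i) => x y /= ->; rewrite oppr0.
Qed.

Lemma superpose_in a : superpose V a \in Vh.
Proof.
apply: limg_annihilator => phi phiV; rewrite -Remx_mull mulmx_sumr big1.
  by apply/matrixP => ? ?; rewrite !mxE.
by move=> i _; rewrite mulmxA real_blocks_annihilator ?mul0mx.
Qed.

Lemma superpose_surj x : x \in Vh -> exists a, x = superpose V a.
Proof.
case/memv_imgP=> y _ ->; rewrite mxfunE -[y]submxcolK mul_mxrow_mxcol.
(* The imaginary part of z is the real part of - i z. *)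
exists (fun i => (if complex.Im (lam i) < 0 then - 'i%C else 1) *: rcmx (submxcol y i)).
rewrite /superpose Remx_sum; apply: eq_bigr => i _.
case: ifP => _; last by rewrite scale1r Remx_mulr.
by rewrite -Remx_Ni -scalemxAr -Remx_mulr scalemxAl.
Qed.

(** The state and the input of an output-nulling trajectory: one step multiplies
    each parameter by its node. *)
Lemma superpose_step a :
  A *m superpose V a + B *m superpose W a = superpose V (fun i => lam i *: a i) /\
  C *m superpose V a + D *m superpose W a = 0.
Proof.
rewrite -!Remx_mull -!RemxD !mulmx_sumr -!big_split /=; split.
  congr Remx; apply: eq_bigr => i _.
  by rewrite !mulmxA -mulmxDl (kernel_modes i).1 -scalemxAl scalemxAr.
rewrite big1; first by apply/matrixP => ? ?; rewrite !mxE.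
by move=> i _; rewrite !mulmxA -mulmxDl (kernel_modes i).2 mul0mx.
Qed.

Lemma output_nulling_Vh : output_nulling A B C D Vh.
Proof.
apply/output_nullingP => v /superpose_surj[a ->].
have [stepA stepC] := superpose_step a.
by exists (superpose W a); rewrite ?stepA ?superpose_in.
Qed.

Lemma reach_in_Vh_stable :
  (reach_in A B C D Vh h.+1 <= reach_in A B C D Vh h)%VS.
Proof.
apply: reach_in_stable => b /superpose_surj[a def_b].
pose a_ j i := lam i ^+ j *: a i.
have step j : superpose V (a_ j.+1) = A *m superpose V (a_ j) + B *m superpose W (a_ j).
  rewrite (superpose_step _).1; congr Remx; apply: eq_bigr => i _.
  by rewrite scalerA -exprS.
exists (fun j => superpose V (a_ j)), (fun j => superpose W (a_ j)),
  (fun j => - complex.Re (node_poly lam)`_j); split=> //.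
- rewrite def_b; congr Remx; apply: eq_bigr => i _.
  by rewrite /a_ expr0 scale1r.
- by move=> j; exact: superpose_in.
- by move=> j; exact: (superpose_step _).2.
under [RHS]eq_bigr => j _ do rewrite -RemxZ scaler_sumr.
rewrite -Remx_sum exchange_big; congr Remx; apply: eq_bigr => i _ /=.
rewrite /a_ node_pow scaler_suml mulmx_sumr; apply: eq_bigr => j _.
by rewrite rmorphN /= node_poly_real scalemxAr scalerA.
Qed.

Lemma output_nulling_Sseq_sub_Vh T :
  output_nulling A B C D T -> (T <= Sseq A B C D h)%VS -> (T <= Vh)%VS.
Proof.
move=> nullT TS; apply/subvP => x xT; apply: limg_annihilator => phi phiV.
have fact_phi i : exists w : 'rV[R[i]]_(n + p),
    row_mx (rcmx phi) 0 == w *m rosenbrock A B C D (lam i).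
  have [z Pz | w ->] := @row_factor _ _ _ (rosenbrock A B C D (lam i))
     (row_mx (rcmx phi) 0); last by exists w.
  have [a ->] := kernel_spanned Pz.
  by rewrite mul_col_mx mul_row_col mul0mx addr0 mulmxA real_blocks_annihilator ?mul0mx.
pose w i := xchoose (fact_phi i).
have wP i : row_mx (rcmx phi) 0 = row_mx
    (lsubmx (w i) *m (rcmx A - (lam i)%:M) + rsubmx (w i) *m rcmx C)
    (lsubmx (w i) *m rcmx B + rsubmx (w i) *m rcmx D).
  rewrite -mul_row_block hsubmxK; exact/eqP/(xchooseP (fact_phi i)).
have phi0 : rcmx phi *m rcmx x = 0.
  apply: (@annihilator_output_nulling _ _ (real_complex R) _ _ _ A B C D h lam _
    (fun i => lsubmx (w i)) (fun i => rsubmx (w i)) lam_distinct _ _ T) => // i.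
    by have [-> _] := eq_row_mx (wP i); rewrite mulmxBr mul_mx_scalar addrAC subrK.
  by have [_ <-] := eq_row_mx (wP i).
by apply: (map_mx_inj (f := real_complex R)); rewrite map_mxM phi0 map_mx0.
Qed.

End KernelModes.

Theorem theorem5 (R : realType) (n m p : nat)
    (A : 'M[R]_n) (B : 'M[R]_(n, m)) (C : 'M[R]_(p, n)) (D : 'M[R]_(p, m))
    (h : nat) (lam : 'I_h -> R[i])
    (k : 'I_h -> nat)
    (V : forall i : 'I_h, 'M[R[i]]_(n, k i))
    (W : forall i : 'I_h, 'M[R[i]]_(m, k i))
    (lam_distinct : injective lam)
    (lam_selfconj : forall i : 'I_h, exists j : 'I_h, lam j = conjc (lam i))
    (lam_not_zero : forall i : 'I_h, ~ invariant_zero A B C D (lam i))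
    (VW_basis : forall i : 'I_h,
      basis_mx (col_mx (V i) (W i)) (lker (mxfun (rosenbrock A B C D (lam i)))))
    (V_conj : forall i j : 'I_h,
      lam j = conjc (lam i) -> conj_mx (V i) (V j)) :
  let Vh : {vspace 'cV[R]_n} := limg (mxfun (real_blocks lam V)) in
  (exists Rh : {vspace 'cV[R]_n}, reachability_subspace A B C D Vh Rh) /\
  (forall Rh : {vspace 'cV[R]_n}, reachability_subspace A B C D Vh Rh ->
     supremal_output_nulling A B C D (Sseq A B C D h) Rh).
Proof.
move=> Vh.
have stab : (reach_in A B C D Vh h.+1 <= reach_in A B C D Vh h)%VS.
  exact: reach_in_Vh_stable VW_basis V_conj.
split.
  have [F frF] : output_nulling A B C D Vh by exact: output_nulling_Vh VW_basis V_conj.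
  by exists (reach_in A B C D Vh h), F => //; exact: smallest_invariant_reach_in.
move=> Rh [F frF /smallest_invariant_uniq uniqRh].
rewrite (uniqRh _ (smallest_invariant_reach_in frF stab)); split.
- exact: output_nulling_reach_in frF stab.
- exact: reach_in_Sseq.
by apply: sub_reach_in => T; exact: output_nulling_Sseq_sub_Vh VW_basis V_conj T.
Qed.
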